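(* Let $G=\langle A\mid R\rangle$ be a finitely presented group. Then there is a non-deterministic two-tape Turing machine $M$ such that the space function $S_G(n)$ of $G$ is equivalent to the space complexity $S_M(n)$ of $M$, and the language accepted by $M$ coincides with the set of words over $A^{\pm1}$ equal to $1$ in $G$.
   Context: Equivalence. For non-decreasing functions $f,g$ on $\mathbb{N}$, write $f\preceq g$ if there is a positive integer $c$ with $f(n)\le c\,g(cn)+cn$ for all $n\in\mathbb{N}$; $f,g$ are equivalent ($f\sim g$) if $f\preceq g$ and $g\preceq f$. Space function of a group. Let $G=\langle A\mid R\rangle$ with $A,R$ finite. Consider finite sequences $W=(w_1,\dots,w_s)$ of words over $A^{\pm1}$, with $\|W\|=\sum_i\|w_i\|$, where $\|w\|$ is the number of letters of $w$. An elementary $R$-transformation of $W$ does one of the following for one $w_i$: removes from or inserts into $w_i$ a subword $aa^{-1}$ ($a\in A^{\pm1}$); removes from or inserts into $w_i$ a subword $r$ or $r^{-1}$ ($r\in R$); replaces $w_i$ by a cyclic conjugate; if $w_i\equiv uv$, replaces the entry $w_i$ by the two entries $u,v$; deletes the entry $w_i$ if it is the empty word. The space of a rewriting $W_0\to\dots\to W_t$ (each step an elementary $R$-transformation) is $\max_j\|W_j\|$. If $w=1$ in $G$, $space_G(w)$ is the minimum of the spaces of all rewritings starting with $(w)$ and ending with the empty sequence $(\,)$. The space function is $S_G(n)=\max\{space_G(w): w=1 \text{ in } G,\ \|w\|\le n\}$. Up to $\sim$ it does not depend on the finite presentation. Turing machines. Machines are multi-tape recognizing Turing machines (possibly non-deterministic)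 with an input alphabet $X$, one head per tape, tapes on which squares can be inserted and deleted, a vector of start states and a vector of accept states. An input configuration has a word $u$ over $X$ on the first tape with the head at its right end, all other tapes empty, and start states; the accept configuration has accept states and empty tapes. A word $u$ is accepted if some computation leads from its input configuration to the accept configuration. The space of a computation is the maximum, over its configurations, of the number of tape letters in the configuration; $space_M(u)$ is the minimal space of a computation accepting $u$; the space complexity is $S_M(n)=\max\{space_M(u): u \text{ accepted by } M,\ \|u\|\le n\}$. (Counting or not counting the input tape does not change the $\sim$-class.) *)

(* Defs.v *)
From mathcomp Require Import all_boot.
From mathcomp Require Import boolp classical_sets.

Set Implicit Arguments.
Unset Strict Implicit.
Unset Printing Implicit Defensive.

(** ** Growth of functions *)

Definition preceq (f g : nat -> nat) : Prop :=
  exists c : nat, 0 < c /\ forall n, f n <= c * g (c * n) + c * n.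

Definition growth_equiv (f g : nat -> nat) : Prop := preceq f g /\ preceq g f.

(** ** Minimum and maximum of a set of natural numbers *)

(* Both are 0 when the minimum (resp. maximum) does not exist. Below this only
   happens for the minimum or maximum of an empty set. *)
Definition nat_min (P : nat -> Prop) : nat :=
  xget 0 (fun m => P m /\ forall k, P k -> m <= k).

Definition nat_max (P : nat -> Prop) : nat :=
  xget 0 (fun m => P m /\ forall k, P k -> k <= m).

(** ** Finite sequences of steps and their space *)

Section Runs.
Variables (T : Type) (step : T -> T -> Prop) (weight : T -> nat).

Fixpoint chain (x : T) (s : seq T) : Prop :=
  if s is y :: s' then step x y /\ chain y s' else True.

Definition run (x y : T) (s : seq T) : Prop := chain x s /\ last x s = y.

Definition run_space (x : T) (s : seq T) : nat := \max_(z <- x :: s) weight z.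

Definition min_space (x y : T) : nat :=
  nat_min (fun m => exists2 s, run x y s & m = run_space x s).

End Runs.

(** ** Finite group presentations *)

(* The letters of A^{±1}: (a, false) stands for a and (a, true) for a^-1. *)
Notation letter A := (A * bool)%type.
Notation word A := (seq (letter A)).

Definition inv_letter (A : Type) (x : letter A) : letter A := (x.1, ~~ x.2).

Definition inv_word (A : Type) (w : word A) : word A :=
  rev (map (@inv_letter A) w).

Section Presentation.
Variables (A : finType) (R : seq (word A)).

(* G = <A | R> is the quotient of the free monoid on A^{±1} by this congruence,
   the least one that kills the words a a^-1 and the relators. *)
Inductive group_eq : word A -> word A -> Prop :=
| group_eq_refl u : group_eq u u
| group_eq_sym u v : group_eq u v -> group_eq v u
| group_eq_trans u v w : group_eq u v -> group_eq v w -> group_eq u w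
| group_eq_cat u u' v v' :
    group_eq u u' -> group_eq v v' -> group_eq (u ++ v) (u' ++ v')
| group_eq_cancel a : group_eq [:: a; inv_letter a] [::]
| group_eq_rel r : r \in R -> group_eq r [::].

Definition trivial_in_group (w : word A) : Prop := group_eq w [::].

Inductive entry_step : word A -> word A -> Prop :=
| insert_cancel u v a : entry_step (u ++ v) (u ++ [:: a; inv_letter a] ++ v)
| remove_cancel u v a : entry_step (u ++ [:: a; inv_letter a] ++ v) (u ++ v)
| insert_rel u v r : r \in R -> entry_step (u ++ v) (u ++ r ++ v)
| remove_rel u v r : r \in R -> entry_step (u ++ r ++ v) (u ++ v)
| insert_inv_rel u v r : r \in R -> entry_step (u ++ v) (u ++ inv_word r ++ v)
| remove_inv_rel u v r : r \in R -> entry_step (u ++ inv_word r ++ v) (u ++ v)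
| cyclic_conj u v : entry_step (u ++ v) (v ++ u).

Inductive elementary : seq (word A) -> seq (word A) -> Prop :=
| elem_entry W1 W2 w w' :
    entry_step w w' -> elementary (W1 ++ w :: W2) (W1 ++ w' :: W2)
| elem_split W1 W2 u v :
    elementary (W1 ++ (u ++ v) :: W2) (W1 ++ u :: v :: W2)
| elem_delete W1 W2 : elementary (W1 ++ [::] :: W2) (W1 ++ W2).

Definition total_length (W : seq (word A)) : nat := \sum_(w <- W) size w.

Definition word_space (w : word A) : nat :=
  min_space elementary total_length [:: w] [::].

Definition space_function (n : nat) : nat :=
  nat_max (fun m => exists w,
    [/\ trivial_in_group w, size w <= n & m = word_space w]).

End Presentation.

(** ** Turing machines *)

(* What a command does on one tape: it replaces a factor u q v around the head
   by u' q' v'. The flags require u (resp. v) to reach the left (resp. right)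
   end of the tape. Since u, v, u', v' are arbitrary, squares can be inserted
   and deleted. *)
Record tape_rule (Y Q : Type) := TapeRule {
  at_left_end : bool;
  at_right_end : bool;
  old_left : seq Y;
  old_state : Q;
  old_right : seq Y;
  new_left : seq Y;
  new_state : Q;
  new_right : seq Y
}.

(* The content u q v of a tape, with the head between u and v. *)
Record tape (Y Q : Type) := Tape {
  left_part : seq Y;
  head_state : Q;
  right_part : seq Y
}.

Definition tape_step (Y Q : Type) (r : tape_rule Y Q) (t t' : tape Y Q) : Prop :=
  exists x y : seq Y,
    [/\ t = Tape (x ++ old_left r) (old_state r) (old_right r ++ y),
        t' = Tape (x ++ new_left r) (new_state r) (new_right r ++ y),
        at_left_end r -> x = [::]
      & at_right_end r -> y = [::]].

(* A machine with k tapes and input alphabet X. The type tape_letter (resp.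
   state) is the union of the alphabets (resp. of the sets of head states) of
   the k tapes. Several commands may apply to one configuration. *)
Record turing_machine (X : finType) (k : nat) := TuringMachine {
  tape_letter : finType;
  state : finType;
  command : finType;
  rule : command -> 'I_k -> tape_rule tape_letter state;
  input_letter : X -> tape_letter;
  input_letter_inj : injective input_letter;
  start_state : 'I_k -> state;
  accept_state : 'I_k -> state
}.

Section Machine.
Variables (X : finType) (k : nat) (M : turing_machine X k).

Definition config : Type := {ffun 'I_k -> tape (tape_letter M) (state M)}.

Definition machine_step (C C' : config) : Prop :=
  exists theta : command M, forall i, tape_step (rule theta i) (C i) (C' i).

Definition input_config (u : seq X) : config :=
  [ffun i : 'I_k =>
    Tape (if i == 0 :> nat then map (@input_letter _ _ M) u else [::])
         (start_state M i) [::]].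

Definition accept_config : config :=
  [ffun i : 'I_k => Tape [::] (accept_state M i) [::]].

Definition config_size (C : config) : nat :=
  \sum_(i < k) (size (left_part (C i)) + size (right_part (C i))).

Definition accepts (u : seq X) : Prop :=
  exists s, run machine_step (input_config u) accept_config s.

Definition input_space (u : seq X) : nat :=
  min_space machine_step config_size (input_config u) accept_config.

Definition space_complexity (n : nat) : nat :=
  nat_max (fun m => exists u,
    [/\ accepts u, size u <= n & m = input_space u]).

End Machine.

(* Main.v *)
Require Import Defs.
From mathcomp Require Import all_boot.
From mathcomp Require Import boolp classical_sets zify.

(* The machine keeps a sequence of words on its first tape as w_0 # w_1 # ... and
   ignores the second tape. Commands insert or erase relators, their inverses
   and a a^-1 next to the head, insert #, and erase # next to an empty entry. A
   cyclic shift takes a letter from the front of an entry into the head state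
   and drops it at the end of the entry; reading a carried letter as already
   standing there, every command either fixes the sequence of words or is an
   elementary transformation, and the two spaces differ by at most 1.
   Conversely the machine follows a rewriting while storing only its nonempty
   entries, so that there are at most as many # as letters and the space at most
   doubles, up to 1. The additive constants are absorbed for n > 0; for n = 0
   both space functions vanish. *)

Set Implicit Arguments.
Unset Strict Implicit.
Unset Printing Implicit Defensive.

(** * Minima and maxima of sets of natural numbers *)

Lemma nat_minP (P : nat -> Prop) m :
  P m -> P (nat_min P) /\ forall k, P k -> nat_min P <= k.
Proof.
move=> Pm; apply: (@xgetPex _ 0 (fun m => P m /\ forall k, P k -> m <= k)).
have exP : exists n, `[< P n >] by exists m; apply/asboolP.
case: (ex_minnP exP) => n /asboolP Pn n_min; exists n; split=> // k Pk.
exact/n_min/asboolP.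
Qed.

Lemma nat_max_le (P : nat -> Prop) b :
  (forall k, P k -> k <= b) -> nat_max P <= b.
Proof.
move=> leb; rewrite /nat_max; case: xgetP => [n _ [Pn _]|_]; last by [].
exact: leb.
Qed.

Lemma le_nat_max (P : nat -> Prop) b m :
  (forall k, P k -> k <= b) -> P m -> m <= nat_max P.
Proof.
move=> leb Pm.
suff: P (nat_max P) /\ forall k, P k -> k <= nat_max P by case=> _; apply.
apply: (@xgetPex _ 0 (fun m => P m /\ forall k, P k -> k <= m)).
have exP : exists n, `[< P n >] by exists m; apply/asboolP.
have ub n : `[< P n >] -> n <= b by move/asboolP/leb.
case: (ex_maxnP exP ub) => n /asboolP Pn n_max; exists n; split=> // k Pk.
exact/n_max/asboolP.
Qed.

(** Over a finite alphabet there are finitely many words of length at most [n]. This makes the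
    maxima in [space_function] and [space_complexity] genuine instead of the default 0. *)
Lemma short_words_bounded (X : finType) (F : seq X -> nat) n :
  exists b, forall w, size w <= n -> F w <= b.
Proof.
elim: n F => [|n IHn] F.
  by exists (F [::]) => w; rewrite leqn0 size_eq0 => /eqP->.
have [b Fb] := fin_all_exists (fun a => IHn (fun w => F (a :: w))).
exists (F [::] + \max_a b a) => -[|a w] /=; first by rewrite leq_addr.
move=> /Fb/leq_trans; apply; apply: leq_trans (leq_addl _ _).
exact: leq_bigmax.
Qed.

(** * Runs in bounded space *)

Section Reachability.
Variables (T : Type) (step : T -> T -> Prop) (weight : T -> nat).

(** Runs that stay within space [m], in inductive form, so that simulations carry their space bound
    through the induction. *)
Inductive reach (m : nat) : T -> T -> Prop :=
| reach_refl x : weight x <= m -> reach m x x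
| reach_cons x y z :
    weight x <= m -> step x y -> reach m y z -> reach m x z.

Lemma reach_trans m x y z : reach m x y -> reach m y z -> reach m x z.
Proof.
move=> xy yz; elim: xy yz => // {}x y' z' lex st _ IH /IH; exact: reach_cons.
Qed.

Lemma reach1 m x y :
  weight x <= m -> weight y <= m -> step x y -> reach m x y.
Proof. by move=> lex ley st; apply: (reach_cons lex st); apply: reach_refl. Qed.

Lemma reach_leq m n x y : m <= n -> reach m x y -> reach n x y.
Proof.
move=> lemn; elim=> [z lez|x' y' z lex st _ IH].
  exact: reach_refl (leq_trans lez lemn).
exact: reach_cons (leq_trans lex lemn) st IH.
Qed.

Lemma reach_weight_start m x y : reach m x y -> weight x <= m.
Proof. by case. Qed.

Lemma reachP m x y :
  reach m x y <-> exists2 s, run step x y s & run_space weight x s <= m.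
Proof.
split=> [|[s]].
  elim=> [z lez|x' y' z lex st _ [s [ch lst] sp]].
    by exists [::] => //; rewrite /run_space big_seq1.
  by exists (y' :: s) => //; rewrite /run_space big_cons geq_max lex.
elim: s x => [|z s IHs] x [/=].
  by move=> _ <-; rewrite /run_space big_seq1; apply: reach_refl.
move=> [st ch] lst; rewrite /run_space big_cons geq_max => /andP[lex sp].
by apply: (reach_cons lex st); apply: IHs.
Qed.

(** One run makes the set of possible spaces nonempty, so its minimum is attained and is not a
    default value. *)
Lemma min_spaceP m x y : reach m x y ->
  reach (min_space step weight x y) x y /\ min_space step weight x y <= m.
Proof.
move=> /reachP[s rs lem].
pose P m := exists2 s, run step x y s & m = run_space weight x s.
have Ps : P (run_space weight x s) by exists s.
have [[s' rs' e] min_le] := nat_minP Ps.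
split; last exact: leq_trans (min_le _ Ps) lem.
by apply/reachP; exists s' => //; rewrite -e.
Qed.

End Reachability.

(** * Rewriting in the group and triviality of words *)

Section GroupRewriting.
Variables (A : finType) (R : seq (word A)).

(** Putting relators, their inverses and the words [a a^-1] in one finite list reduces the six
    insertions and removals to two cases. *)
Definition pieces : seq (word A) :=
  R ++ map (@inv_word A) R ++ [seq [:: a; inv_letter a] | a <- enum {: letter A}].

Lemma pieces_rel r : r \in R -> r \in pieces.
Proof. by move=> rR; rewrite mem_cat rR. Qed.

Lemma pieces_inv_rel r : r \in R -> inv_word r \in pieces.
Proof. by move=> rR; rewrite !mem_cat map_f ?orbT. Qed.

Lemma pieces_cancel a : [:: a; inv_letter a] \in pieces.
Proof.
rewrite !mem_cat [X in [|| _, _ | X]](map_f (fun a => [:: a; inv_letter a])) ?orbT //.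
by rewrite mem_enum.
Qed.

Lemma piecesP p : p \in pieces ->
  [\/ p \in R, exists2 r, r \in R & p = inv_word r
    | exists a, p = [:: a; inv_letter a]].
Proof.
rewrite !mem_cat => /or3P[pR|/mapP[r rR ->]|/mapP[a _ ->]].
- by constructor 1.
- by constructor 2; exists r.
- by constructor 3; exists a.
Qed.

Lemma insert_piece u v p : p \in pieces -> entry_step R (u ++ v) (u ++ p ++ v).
Proof.
by move=> /piecesP[pR|[r rR ->]|[a ->]];
   [apply: insert_rel | apply: insert_inv_rel | apply: insert_cancel].
Qed.

Lemma remove_piece u v p : p \in pieces -> entry_step R (u ++ p ++ v) (u ++ v).
Proof.
by move=> /piecesP[pR|[r rR ->]|[a ->]];
   [apply: remove_rel | apply: remove_inv_rel | apply: remove_cancel].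
Qed.

Lemma entry_step_ind_pieces (P : word A -> word A -> Prop) :
  (forall u v p, p \in pieces -> P (u ++ v) (u ++ p ++ v)) ->
  (forall u v p, p \in pieces -> P (u ++ p ++ v) (u ++ v)) ->
  (forall u v, P (u ++ v) (v ++ u)) ->
  forall w w', entry_step R w w' -> P w w'.
Proof.
move=> ins del cyc w w' [] *; first [exact: cyc | apply: ins | apply: del];
  by [apply: pieces_cancel | apply: pieces_rel | apply: pieces_inv_rel].
Qed.

Lemma inv_wordV u : group_eq R (u ++ inv_word u) [::].
Proof.
elim: u => [|a u IHu]; first exact: group_eq_refl.
rewrite /inv_word /= rev_cons -cats1 -/(inv_word u) -(cat1s a).
rewrite (catA u); apply: group_eq_trans (group_eq_cancel R a).
rewrite -[[:: a; _]]cat1s; apply: group_eq_cat; first exact: group_eq_refl.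
rewrite -[X in group_eq _ _ X]cat0s.
apply: group_eq_cat IHu _; exact: group_eq_refl.
Qed.

Lemma group_eq_insert u v p :
  group_eq R p [::] -> group_eq R (u ++ p ++ v) (u ++ v).
Proof.
move=> p1; apply: group_eq_cat; first exact: group_eq_refl.
rewrite -[X in group_eq _ _ X]cat0s.
apply: group_eq_cat p1 _; exact: group_eq_refl.
Qed.

Lemma trivial_piece p : p \in pieces -> trivial_in_group R p.
Proof.
move=> /piecesP[pR|[r rR ->]|[a ->]]; last exact: group_eq_cancel.
  exact: group_eq_rel.
(* Since [r] is trivial, [inv_word r] equals [r ++ inv_word r], which cancels. *)
apply: group_eq_trans (inv_wordV r); apply: group_eq_sym.
have := @group_eq_insert [::] (inv_word r) r; apply; exact: group_eq_rel.
Qed.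

Lemma trivial_conj u v :
  trivial_in_group R (v ++ u) -> trivial_in_group R (u ++ v).
Proof.
move=> vu1; apply: group_eq_trans (inv_wordV u).
(* In the group, [u ++ v] is the conjugate [u (v u) u^-1]. *)
apply: group_eq_trans (group_eq_insert u (inv_word u) vu1).
rewrite !catA -catA -[X in group_eq _ X]cats0.
apply: group_eq_cat; first exact: group_eq_refl.
apply: group_eq_sym; exact: inv_wordV.
Qed.

Lemma trivial_entry_step w w' :
  entry_step R w w' -> trivial_in_group R w' -> trivial_in_group R w.
Proof.
elim/entry_step_ind_pieces: w w' / => [u v p pP|u v p pP|u v].
- apply: group_eq_trans; apply/group_eq_sym/group_eq_insert/trivial_piece/pP.
- apply: group_eq_trans; apply/group_eq_insert/trivial_piece/pP.
- exact: trivial_conj.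
Qed.

(** Triviality is pulled back along a rewriting: a split entry is a product of two trivial words and
    a deleted entry is empty. At the final empty sequence the condition is vacuous. *)
Lemma trivial_elementary W W' : elementary R W W' ->
  {in W', forall w, trivial_in_group R w} ->
  {in W, forall w, trivial_in_group R w}.
Proof.
case=> [W1 W2 w w' st|W1 W2 u v|W1 W2] triv z;
  rewrite mem_cat inE => /or3P[zW|/eqP->|zW];
  try by apply: triv; rewrite !mem_cat ?inE zW ?orbT.
- by apply: trivial_entry_step st (triv _ _); rewrite mem_cat inE eqxx orbT.
- have := group_eq_cat (triv u _) (triv v _).
  by apply; rewrite mem_cat !inE eqxx ?orbT.
- exact: group_eq_refl.
Qed.

Notation group_reach := (reach (elementary R) (@total_length A)).

Lemma trivial_of_reach m w : group_reach m [:: w] [::] -> trivial_in_group R w.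
Proof.
suff gen W W' : group_reach m W W' -> W' = [::] ->
    {in W, forall w, trivial_in_group R w}.
  by move=> /gen/(_ erefl)/(_ w); apply; rewrite inE.
elim=> [z _ -> //|{}W V {}W' _ st _ IH] W'0.
exact: trivial_elementary st (IH W'0).
Qed.

Lemma total_length1 (w : word A) : total_length [:: w] = size w.
Proof. by rewrite /total_length big_seq1. Qed.

Lemma reach_of_trivial w :
  trivial_in_group R w -> exists m, group_reach m [:: w] [::].
Proof.
(* The space is left existential: only the existence of some rewriting is at stake. *)
pose conn u v := exists m, group_reach m [:: u] [:: v].
have conn_refl u : conn u u.
  by exists (total_length [:: u]); apply: reach_refl.
have conn_trans u v z : conn u v -> conn v z -> conn u z.
  move=> [m uv] [n vz]; exists (maxn m n); apply: (@reach_trans _ _ _ _ _ [:: v]).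
    exact: reach_leq (leq_maxl _ _) uv.
  exact: reach_leq (leq_maxr _ _) vz.
have conn_step u v : entry_step R u v -> conn u v.
  move=> st; exists (maxn (total_length [:: u]) (total_length [:: v])).
  apply: reach1; rewrite ?leq_maxl ?leq_maxr //.
  exact: (@elem_entry _ _ [::] [::]).
have conn_piece p x y : p \in pieces ->
    conn (x ++ p ++ y) (x ++ y) /\ conn (x ++ y) (x ++ p ++ y).
  by split; apply: conn_step; [apply: remove_piece | apply: insert_piece].
(* The arbitrary context makes the induction pass through concatenation, and having both directions
   makes it pass through symmetry. *)
have conn_eq u v : group_eq R u v -> forall x y,
    conn (x ++ u ++ y) (x ++ v ++ y) /\ conn (x ++ v ++ y) (x ++ u ++ y).
  elim=> {u v} [u|u v _ IH|u v z _ IH1 _ IH2|u u' v v' _ IH1 _ IH2|a|r rR] x y.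
  - by split.
  - by have [] := IH x y.
  - have [uv vu] := IH1 x y; have [vz zv] := IH2 x y.
    by split; [apply: conn_trans vz | apply: conn_trans vu].
  - have [uv vu] := IH1 x (v ++ y); have [vz zv] := IH2 (x ++ u') y.
    rewrite -!catA in vz zv *.
    by split; [apply: conn_trans vz | apply: conn_trans vu].
  - exact/conn_piece/pieces_cancel.
  - exact/conn_piece/pieces_rel.
move=> /conn_eq/(_ [::] [::])[[m wm] _]; exists m.
rewrite !cats0 /= in wm; apply: reach_trans wm _.
apply: reach1; rewrite /total_length ?big_seq1 ?big_nil //.
exact: (@elem_delete _ _ [::] [::]).
Qed.

End GroupRewriting.

(** * The commands acting on the first tape *)

Section Machine.
Variables (A : finType) (R : seq (word A)).

Local Notation symbol := (option (letter A)).
Local Notation status := (option (option (letter A))).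
Local Notation sep := (None : symbol).
Local Notation idle := (Some None : status).
Local Notation carry a := (Some (Some a) : status).
Local Notation accepted := (None : status).
Local Notation letters p := (map Some p : seq symbol).

(** Tuples instead of [tape_rule] records come with decidable equality, so a list of them yields a
    finite type of commands. *)
Definition raw_rule : Type :=
  (bool * bool * (seq symbol * status * seq symbol)
   * (seq symbol * status * seq symbol))%type.

Definition to_rule (r : raw_rule) : tape_rule symbol status :=
  let: (le, re, (u, q, v), (u', q', v')) := r in
  TapeRule le re u q v u' q' v'.

Definition idle_rule (re : bool) (v u' v' : seq symbol) : raw_rule :=
  (false, re, ([::], idle, v), (u', idle, v')).

(** A separator is erased only before another separator or the right end, that is, when the entry
    after it is empty. A letter is picked up only just after a separator, and never carried across
    one, so it is dropped in its own entry. *)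
Definition rules : seq raw_rule :=
  [seq idle_rule false [:: s] [:: s] [::] | s <- enum {: symbol}]
  ++ [seq (false, false, ([:: s], idle, [::]), ([::], idle, [:: s]))
       | s <- enum {: symbol}]
  ++ [seq idle_rule false [::] [::] (letters p) | p <- pieces R]
  ++ [seq idle_rule false (letters p) [::] [::] | p <- pieces R]
  ++ [:: idle_rule false [::] [::] [:: sep];
         idle_rule false [:: sep; sep] [::] [:: sep];
         idle_rule true [:: sep] [::] [::];
         (true, true, ([::], idle, [::]), ([::], accepted, [::]))]
  ++ [seq (false, false, ([:: sep], idle, [:: Some a]),
                         ([:: sep], carry a, [::])) | a <- enum {: letter A}]
  ++ [seq (false, false, ([::], carry ab.1, [:: Some ab.2]),
                         ([:: Some ab.2], carry ab.1, [::]))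
       | ab <- enum {: letter A * letter A}]
  ++ [seq (false, false, ([::], carry a, [:: sep]),
                         ([::], idle, [:: Some a; sep])) | a <- enum {: letter A}]
  ++ [seq (false, true, ([::], carry a, [::]),
                        ([::], idle, [:: Some a])) | a <- enum {: letter A}].

Local Notation stape := (tape symbol status).
Local Notation at_ x y := (Tape x idle y : stape).

Definition step1 (t t' : stape) : Prop :=
  exists2 r, r \in rules & tape_step (to_rule r) t t'.

Definition tape_size (t : stape) : nat :=
  size (left_part t) + size (right_part t).

(** The rules with their contexts and end flags spelled out, for case analysis. *)
Inductive local_step : stape -> stape -> Prop :=
| move_right x s y : local_step (at_ x (s :: y)) (at_ (rcons x s) y)
| move_left x s y : local_step (at_ (rcons x s) y) (at_ x (s :: y))
| write_piece x p y : p \in pieces R -> local_step (at_ x y) (at_ x (letters p ++ y))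
| erase_piece x p y : p \in pieces R -> local_step (at_ x (letters p ++ y)) (at_ x y)
| write_sep x y : local_step (at_ x y) (at_ x (sep :: y))
| erase_sep x y : local_step (at_ x [:: sep, sep & y]) (at_ x (sep :: y))
| erase_sep_end x : local_step (at_ x [:: sep]) (at_ x [::])
| accept_empty : local_step (at_ [::] [::]) (Tape [::] accepted [::])
| carry_begin x a y :
    local_step (at_ (rcons x sep) (Some a :: y)) (Tape (rcons x sep) (carry a) y)
| carry_move x a b y :
    local_step (Tape x (carry a) (Some b :: y)) (Tape (rcons x (Some b)) (carry a) y)
| carry_end x a y :
    local_step (Tape x (carry a) (sep :: y)) (at_ x [:: Some a, sep & y])
| carry_end_right_end x a :
    local_step (Tape x (carry a) [::]) (at_ x [:: Some a]).

Lemma step1P t t' : step1 t t' <-> local_step t t'.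
Proof.
split=> [[r]|].
  rewrite !mem_cat; case/orP=> [/mapP[s _ ->]|].
    by case=> x [y [-> -> _ _]] /=; rewrite cats0 cats1; constructor.
  case/orP=> [/mapP[s _ ->]|].
    by case=> x [y [-> -> _ _]] /=; rewrite cats0 cats1; constructor.
  case/orP=> [/mapP[p pP ->]|].
    by case=> x [y [-> -> _ _]] /=; rewrite cats0; constructor.
  case/orP=> [/mapP[p pP ->]|].
    by case=> x [y [-> -> _ _]] /=; rewrite cats0; constructor.
  case/orP=> [|].
    rewrite !inE => /or4P[]/eqP-> [x [y [-> -> /= lx ly]]]; rewrite !cats0.
    - by constructor.
    - by constructor.
    - by rewrite ly //; constructor.
    - by rewrite lx // ly //; constructor.
  case/orP=> [/mapP[a _ ->]|].
    by case=> x [y [-> -> _ _]] /=; rewrite cats1; constructor.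
  case/orP=> [/mapP[[a b] _ ->]|].
    by case=> x [y [-> -> _ _]] /=; rewrite cats1 cats0; constructor.
  case/orP=> [/mapP[a _ ->]|/mapP[a _ ->]].
    by case=> x [y [-> -> _ _]] /=; rewrite cats0; constructor.
  case=> x [y [-> -> _ /(_ isT)->]] /=; rewrite cats0; constructor.
have mk le re u q v u' q' v' x y : (le, re, (u, q, v), (u', q', v')) \in rules ->
    (le -> x = [::]) -> (re -> y = [::]) ->
    step1 (Tape (x ++ u) q (v ++ y)) (Tape (x ++ u') q' (v' ++ y)).
  by move=> rP lx ly; eexists; first exact: rP; exists x, y.
case=> [x s y|x s y|x p y pP|x p y pP|x y|x y|x||x a y|x a b y|x a y|x a];
  rewrite -?cats1.
- rewrite -{1}[x]cats0; apply: (@mk false false [::] _ [:: s] [:: s] _ [::]) => //.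
  by rewrite !mem_cat (map_f (fun s => idle_rule false [:: s] [:: s] [::])) ?mem_enum.
- rewrite -{2}[x]cats0; apply: (@mk false false [:: s] _ [::] [::] _ [:: s]) => //.
  by rewrite !mem_cat [X in [|| _, X | _]]map_f ?mem_enum ?orbT.
- rewrite -[x]cats0; apply: (@mk false false [::] _ [::] [::] _ (letters p)) => //.
  by rewrite !mem_cat [X in [|| _, _, X | _]]map_f ?mem_enum ?orbT.
- rewrite -[x]cats0; apply: (@mk false false [::] _ (letters p) [::] _ [::]) => //.
  by rewrite !mem_cat [X in [|| _, _, _, X | _]]map_f ?mem_enum ?orbT.
- rewrite -[x]cats0; apply: (@mk false false [::] _ [::] [::] _ [:: sep]) => //.
  by rewrite !mem_cat inE eqxx ?orbT.
- rewrite -[x]cats0.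
  apply: (@mk false false [::] _ [:: sep; sep] [::] _ [:: sep]) => //.
  by rewrite !mem_cat !inE eqxx ?orbT.
- rewrite -[x]cats0.
  apply: (@mk false true [::] _ [:: sep] [::] _ [::] _ [::]) => //.
  by rewrite !mem_cat !inE eqxx ?orbT.
- apply: (@mk true true [::] _ [::] [::] _ [::] [::] [::]) => //.
  by rewrite !mem_cat !inE eqxx ?orbT.
- apply: (@mk false false [:: sep] _ [:: Some a] [:: sep] _ [::]) => //.
  by rewrite !mem_cat [X in [|| _, _, _, _, _, X | _]]map_f ?mem_enum ?orbT.
- rewrite -{1}[x]cats0.
  apply: (@mk false false [::] _ [:: Some b] [:: Some b] _ [::]) => //.
  rewrite !mem_cat [X in [|| _, _, _, _, _, _, X | _]](_ : _ = true) ?orbT //.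
  by apply/mapP; exists (a, b); rewrite ?mem_enum.
- rewrite -[x]cats0.
  apply: (@mk false false [::] _ [:: sep] [::] _ [:: Some a; sep]) => //.
  by rewrite !mem_cat [X in [|| _, _, _, _, _, _, _, X | _]]map_f ?mem_enum ?orbT.
- rewrite -[x]cats0.
  apply: (@mk false true [::] _ [::] [::] _ [:: Some a] _ [::]) => //.
  by rewrite !mem_cat [X in [|| _, _, _, _, _, _, _, _ | X]]map_f ?mem_enum ?orbT.
Qed.

(** * From computations of the machine to rewritings *)

Fixpoint cut (l : seq symbol) : word A * seq (word A) :=
  match l with
  | [::] => ([::], [::])
  | Some a :: l' => (a :: (cut l').1, (cut l').2)
  | None :: l' => ([::], (cut l').1 :: (cut l').2)
  end.

Definition entries (l : seq symbol) : seq (word A) := (cut l).1 :: (cut l).2.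

(** The end meant here is that of the first entry of [l], where a letter carried in front of [l]
    will be dropped. *)
Fixpoint insert_at_end (a : letter A) (l : seq symbol) : seq symbol :=
  match l with
  | Some b :: l' => Some b :: insert_at_end a l'
  | _ => Some a :: l
  end.

(** [entries] always returns at least one word, so the empty sequence has to be read off from the
    accepting status. *)
Definition decode (t : stape) : seq (word A) :=
  match head_state t with
  | None => [::]
  | Some None => entries (left_part t ++ right_part t)
  | Some (Some a) => entries (left_part t ++ insert_at_end a (right_part t))
  end.

Lemma cut_letters p y : cut (letters p ++ y) = (p ++ (cut y).1, (cut y).2).
Proof. by elim: p => [|a p /= ->] //=; case: (cut y). Qed.

Lemma cut_insert_at_end a y :
  cut (insert_at_end a y) = (rcons (cut y).1 a, (cut y).2).
Proof. by elim: y => [|[b|] y IHy] //=; rewrite IHy. Qed.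

Lemma size_insert_at_end a y : size (insert_at_end a y) = (size y).+1.
Proof. by elim: y => [|[b|] y IHy] //=; rewrite IHy. Qed.

(** [W] lists the entries completed within [x], and [u] is the part of the current entry lying in
    [x]. Neither depends on [y], so a change right of the head can be read off from [cut y]. *)
Lemma entries_cat x : exists W u, forall y,
  entries (x ++ y) = W ++ (u ++ (cut y).1) :: (cut y).2.
Proof.
elim: x => [|[a|] x [W [u IHx]]]; first by exists [::], [::].
  case: W IHx => [|w W] IHx.
    by exists [::], (a :: u) => y; have := IHx y; rewrite /entries /= => -[-> ->].
  exists ((a :: w) :: W), u => y.
  by have := IHx y; rewrite /entries /= => -[-> ->].
by exists ([::] :: W), u => y; rewrite /= -IHx.
Qed.

Lemma total_length_entries l : total_length (entries l) <= size l.
Proof.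
rewrite /total_length /entries big_cons.
by elim: l => [|[a|] l IHl] /=; rewrite ?big_nil // big_cons /=; lia.
Qed.

(** The successor accounts for a carried letter, which [tape_size] does not count. *)
Lemma total_length_decode t : total_length (decode t) <= (tape_size t).+1.
Proof.
rewrite /tape_size; case: t => x [[a|]|] y; rewrite /decode /=.
- apply: leq_trans (total_length_entries _) _.
  by rewrite size_cat size_insert_at_end addnS.
- by apply: leq_trans (total_length_entries _) _; rewrite size_cat.
- by rewrite /total_length big_nil.
Qed.

(** Head moves, and moving or dropping a carried letter, change nothing. Picking a letter up is the
    cyclic conjugation, writing a separator is a split, and erasing one, like accepting, deletes an
    empty entry. *)
Lemma decode_step t t' : local_step t t' ->
  decode t = decode t' \/ elementary R (decode t) (decode t').
Proof.
case=> [x s y|x s y|x p y pP|x p y pP|x y|x y|x||x a y|x a b y|x a y|x a];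
  rewrite /decode /= ?cat_rcons; try by left.
- right; have [W [u E]] := entries_cat x; rewrite !E cut_letters.
  exact/elem_entry/insert_piece.
- right; have [W [u E]] := entries_cat x; rewrite !E cut_letters.
  exact/elem_entry/remove_piece.
- right; have [W [u E]] := entries_cat x; rewrite !E /= cats0.
  exact: elem_split.
- right; have [W [u E]] := entries_cat x; rewrite !E /= cats0.
  by have := elem_delete R (rcons W u) ((cut y).1 :: (cut y).2); rewrite !cat_rcons.
- right; have [W [u E]] := entries_cat x; rewrite !E /= cats0.
  by have := elem_delete R (rcons W u) [::]; rewrite cat_rcons cats0 cats1.
- by right; apply: (@elem_delete _ _ [::] [::]).
- right; have [W [u E]] := entries_cat x; rewrite !E /= cut_insert_at_end.
  rewrite -!(cat_rcons (u ++ [::])); apply: elem_entry.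
  rewrite -cats1 -cat1s; exact: cyclic_conj.
Qed.

Notation tape_reach := (reach step1 tape_size).
Notation group_reach := (reach (elementary R) (@total_length A)).

Lemma decode_reach m t t' :
  tape_reach m t t' -> group_reach m.+1 (decode t) (decode t').
Proof.
elim=> [z lez|x y z lex /step1P st _ IH].
  by apply: reach_refl; apply: leq_trans (total_length_decode z) _.
have [-> //|el] := decode_step st.
by apply: reach_cons el IH; apply: leq_trans (total_length_decode x) _.
Qed.

(** * From rewritings to computations of the machine *)

Definition closed (y : seq symbol) : Prop := y = [::] \/ exists z, y = sep :: z.

(** Closedness says that the current entry stops where [y] starts; this is where the carried letter
    may be dropped. *)
Lemma carry_reach m x a p y : closed y -> size (x ++ Some a :: letters p ++ y) <= m ->
  tape_reach m (Tape x (carry a) (letters p ++ y))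
               (at_ (x ++ letters p) (Some a :: y)).
Proof.
rewrite !size_cat /= size_cat size_map => cl; elim: p x => [|b p IHp] x /= lem.
  rewrite cats0; apply: reach1; rewrite /tape_size /=; try lia.
  by apply/step1P; case: cl => [->|[z ->]]; constructor.
apply: (@reach_cons _ _ _ _ _ (Tape (rcons x (Some b)) (carry a) (letters p ++ y))).
- by rewrite /tape_size /= size_cat size_map; lia.
- by apply/step1P; constructor.
- by rewrite -cat_rcons; apply: IHp; rewrite size_rcons; lia.
Qed.

Lemma reach_rewind m x y : size (x ++ y) <= m ->
  tape_reach m (at_ x y) (at_ [::] (x ++ y)).
Proof.
rewrite size_cat; elim/last_ind: x y => [|x s IHx] y.
  by move=> lem; apply: reach_refl.
rewrite size_rcons cat_rcons => lem; apply: (@reach_cons _ _ _ _ _ (at_ x (s :: y))).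
- by rewrite /tape_size /= size_rcons.
- by apply/step1P; constructor.
- by apply: IHx => /=; lia.
Qed.

Lemma reach_forward m x y : size (x ++ y) <= m ->
  tape_reach m (at_ [::] (x ++ y)) (at_ x y).
Proof.
rewrite size_cat; elim/last_ind: x y => [|x s IHx] y.
  by move=> lem; apply: reach_refl.
rewrite size_rcons cat_rcons => lem.
apply: (@reach_trans _ _ _ _ _ (at_ x (s :: y))); first by apply: IHx => /=; lia.
apply: reach1; rewrite /tape_size /= ?size_rcons; try lia.
by apply/step1P; constructor.
Qed.

(** With the head brought back to the left end, simulations of successive steps compose; head moves
    cost no space. *)
Notation word_reach m l l' := (tape_reach m (at_ [::] l) (at_ [::] l')).

Lemma word_reach_at m x y x' y' :
  tape_reach m (at_ x y) (at_ x' y') ->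
  size (x ++ y) <= m -> size (x' ++ y') <= m ->
  word_reach m (x ++ y) (x' ++ y').
Proof.
move=> re /reach_forward xy /reach_rewind xy'.
exact: reach_trans xy (reach_trans re xy').
Qed.

Lemma word_reach1 m x y x' y' :
  local_step (at_ x y) (at_ x' y') ->
  size (x ++ y) <= m -> size (x' ++ y') <= m ->
  word_reach m (x ++ y) (x' ++ y').
Proof.
move=> st lex lex'; apply: (word_reach_at _ lex lex').
by apply: reach1; rewrite /tape_size /= -?size_cat //; apply/step1P.
Qed.

Lemma word_reach_erase_sep m x y : closed y -> size (x ++ sep :: y) <= m ->
  word_reach m (x ++ sep :: y) (x ++ y).
Proof.
move=> cl lem; apply: word_reach1 => //; last first.
  by apply: leq_trans lem; rewrite !size_cat /= leq_add2l.
by case: cl => [->|[z ->]]; constructor.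
Qed.

Lemma word_reach_rotate1 m x a p y : closed y ->
  size (x ++ sep :: letters (a :: p) ++ y) <= m ->
  word_reach m (x ++ sep :: letters (a :: p) ++ y)
               (x ++ sep :: letters (rcons p a) ++ y).
Proof.
move=> cl lem; rewrite map_rcons cat_rcons -!(cat_rcons sep) (catA _ (letters p)).
move: (lem); rewrite !size_cat /= size_cat size_map => lem'.
apply: word_reach_at; rewrite ?size_cat /= ?size_cat ?size_rcons ?size_map; try lia.
apply: (@reach_cons _ _ _ _ _ (Tape (rcons x sep) (carry a) (letters p ++ y))).
- by rewrite /tape_size /= size_rcons size_cat size_map; lia.
- by apply/step1P; constructor.
- by apply: carry_reach => //; rewrite !size_cat /= size_cat size_rcons size_map; lia.
Qed.

(** The letters of [u] are moved one at a time; each rotation preserves the length of the tape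
    content. *)
Lemma word_reach_rotate m x u v y : closed y ->
  size (x ++ sep :: letters (u ++ v) ++ y) <= m ->
  word_reach m (x ++ sep :: letters (u ++ v) ++ y)
               (x ++ sep :: letters (v ++ u) ++ y).
Proof.
move=> cl; elim: u v => [|a u IHu] v lem.
  by rewrite cats0; apply: reach_refl; rewrite /tape_size /=.
apply: reach_trans (word_reach_rotate1 cl lem) _.
rewrite -cats1 -catA cats1 -(cat_rcons a v); apply: IHu.
by move: lem; rewrite !size_cat /= !size_cat !size_map !size_cat size_rcons /=; lia.
Qed.

Lemma word_reach_entry m w w' x y : entry_step R w w' -> closed y ->
  size (x ++ sep :: letters w ++ y) <= m -> size (x ++ sep :: letters w' ++ y) <= m ->
  word_reach m (x ++ sep :: letters w ++ y) (x ++ sep :: letters w' ++ y).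
Proof.
move=> st cl; elim/entry_step_ind_pieces: w w' / st => [u v p pP|u v p pP|u v] le1 le2.
- move: le1 le2; rewrite !map_cat -!catA -!(cat_rcons sep) !(catA (rcons x sep)).
  by apply: word_reach1; constructor.
- move: le1 le2; rewrite !map_cat -!catA -!(cat_rcons sep) !(catA (rcons x sep)).
  by apply: word_reach1; constructor.
- exact: word_reach_rotate.
Qed.

(* Empty entries leave no trace on the tape: their number is not bounded in
   terms of the total length. *)
Definition block (w : word A) : seq symbol :=
  if w is [::] then [::] else sep :: letters w.

Definition code (W : seq (word A)) : seq symbol := flatten (map block W).

Lemma code_cat W1 W2 : code (W1 ++ W2) = code W1 ++ code W2.
Proof. by rewrite /code map_cat flatten_cat. Qed.

Lemma code_cons w W : code (w :: W) = block w ++ code W.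
Proof. by []. Qed.

Lemma closed_code W : closed (code W).
Proof.
elim: W => [|[|a w] W IHW]; [by left | exact: IHW |].
by right; exists (letters (a :: w) ++ code W).
Qed.

(** The separator is paid for by the first letter of [w], and an empty word has no separator. *)
Lemma size_block w : size (block w) <= 2 * size w.
Proof. by case: w => //= a w; rewrite size_map; lia. Qed.

Lemma size_code W : size (code W) <= 2 * total_length W.
Proof.
rewrite /total_length; elim: W => [|w W IHW]; first by rewrite big_nil.
by rewrite big_cons code_cons size_cat mulnDr leq_add ?size_block.
Qed.

(** An empty entry must be given a separator before it can be rewritten. The strict inequality
    leaves room for it. *)
Lemma word_reach_open m x w y : size (x ++ block w ++ y) < m ->
  word_reach m (x ++ block w ++ y) (x ++ sep :: letters w ++ y).
Proof.
case: w => [|a w] lem /=; last by apply: reach_refl; apply: ltnW.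
apply: word_reach1; [by constructor | exact: ltnW |].
by move: lem; rewrite !size_cat /=; lia.
Qed.

Lemma word_reach_close m x w y : closed y -> size (x ++ block w ++ y) < m ->
  word_reach m (x ++ sep :: letters w ++ y) (x ++ block w ++ y).
Proof.
case: w => [|a w] cl lem /=; last by apply: reach_refl; apply: ltnW.
by apply: word_reach_erase_sep => //; move: lem; rewrite !size_cat /=; lia.
Qed.

(** The factor 2 comes from [size_code], and the successor from the temporary separator of an empty
    entry. An entry is opened, rewritten and closed again; deleting an empty entry leaves the code
    unchanged. *)
Lemma word_reach_elementary m W W' : elementary R W W' ->
  total_length W <= m -> total_length W' <= m ->
  word_reach (2 * m).+1 (code W) (code W').
Proof.
move=> el leW leW'.
have: size (code W) <= 2 * m by apply: leq_trans (size_code W) _; rewrite leq_mul2l.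
have: size (code W') <= 2 * m by apply: leq_trans (size_code W') _; rewrite leq_mul2l.
case: el => [W1 W2 w w' st|W1 W2 u v|W1 W2]; rewrite !code_cat !code_cons => le' le.
- have sep_le z : size (code W1 ++ block z ++ code W2) <= 2 * m ->
    size (code W1 ++ sep :: letters z ++ code W2) <= (2 * m).+1.
    rewrite !size_cat /= size_cat size_map.
    by case: z => [|a z] /=; rewrite ?size_map; lia.
  have cl := closed_code W2.
  apply: reach_trans (word_reach_open _) _ => //.
  apply: reach_trans (word_reach_close cl _) => //.
  by apply: word_reach_entry => //; apply: sep_le.
(* If one half of the split is empty, both codes coincide; otherwise one separator is written
   between the halves. *)
- case: u le le' => [|a u] le le'; first by apply: reach_refl; apply: ltnW.
  case: v le le' => [|b v] le le'.
    by rewrite cats0 in le *; apply: reach_refl; apply: ltnW.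
  move: le le'.
  set x := code W1; set y := code W2.
  have -> : x ++ block ((a :: u) ++ b :: v) ++ y =
      (x ++ sep :: letters (a :: u)) ++ letters (b :: v) ++ y.
    by rewrite /= map_cat -!catA.
  have -> : x ++ block (a :: u) ++ block (b :: v) ++ y =
      (x ++ sep :: letters (a :: u)) ++ sep :: letters (b :: v) ++ y.
    by rewrite -!catA.
  by move=> le le'; apply: word_reach1; [constructor | exact: leqW | exact: leqW].
- by apply: reach_refl; apply: ltnW.
Qed.

Lemma word_reach_code m W W' : group_reach m W W' ->
  word_reach (2 * m).+1 (code W) (code W').
Proof.
elim=> [V leV|x y z lex st yz IH].
  by apply: reach_refl; apply: leqW; apply: leq_trans (size_code V) _; rewrite leq_mul2l.
apply: reach_trans IH; exact: word_reach_elementary (reach_weight_start yz).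
Qed.

Lemma tape_reach_accept m w : group_reach m [:: w] [::] ->
  tape_reach (2 * m).+1 (at_ (letters w) [::]) (Tape [::] accepted [::]).
Proof.
move=> re; have := reach_weight_start re; rewrite total_length1 => lew.
have code1 : size (block w) <= 2 * m.
  by apply: leq_trans (size_block w) _; rewrite leq_mul2l.
apply: reach_trans (reach_rewind _) _; rewrite cats0 ?size_map; first by lia.
apply: (@reach_trans _ _ _ _ _ (at_ [::] (code [:: w]))).
  (* The input has no separator. Writing one in front turns it into an entry that can be rotated,
     preceded by an empty entry. *)
  apply: (@reach_trans _ _ _ _ _ (at_ [::] (sep :: letters w))).
    apply: (@word_reach1 _ [::] (letters w) [::]); rewrite /= ?size_map; try lia.
    by constructor.
  have -> : code [:: w] = block w by rewrite /code /= cats0.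
  (* For empty [w] the new separator is erased again. *)
  have := @word_reach_close (2 * m).+1 [::] w [::].
  by rewrite !cat0s !cats0; apply; first by left.
apply: reach_trans (word_reach_code re) _.
by apply: reach1 => //; apply/step1P; constructor.
Qed.

(** * The two-tape machine *)

Definition start_tape_state (i : 'I_2) : status := idle.
Definition accept_tape_state (i : 'I_2) : status :=
  if i == 0 :> nat then accepted else idle.

(** On the second tape every command demands both ends next to the head and writes nothing, so that
    tape stays empty. *)
Definition group_machine : turing_machine (A * bool)%type 2 :=
  @TuringMachine _ 2 (symbol : finType) (status : finType) (seq_sub rules : finType)
    (fun r i => if i == 0 :> nat then to_rule (ssval r)
                else TapeRule true true [::] idle [::] [::] idle [::])
    Some (@Some_inj _) start_tape_state accept_tape_state.

Local Notation M := group_machine.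

Definition on_first_tape (t : stape) : config M :=
  [ffun i : 'I_2 => if i == 0 :> nat then t else at_ [::] [::]].

Lemma input_configE (w : word A) :
  input_config M w = on_first_tape (at_ (letters w) [::]).
Proof. by apply/ffunP => i; rewrite !ffunE; case: ifP. Qed.

Lemma accept_configE :
  accept_config M = on_first_tape (Tape [::] accepted [::]).
Proof.
by apply/ffunP => i; rewrite !ffunE /= /accept_tape_state; case: ifP.
Qed.

Lemma on_first_tape_inj : injective on_first_tape.
Proof. by move=> t t' /ffunP/(_ ord0); rewrite !ffunE. Qed.

Lemma config_size_on_first_tape t : config_size (on_first_tape t) = tape_size t.
Proof. by rewrite /config_size !big_ord_recl big_ord0 !ffunE /= !addn0. Qed.

Lemma machine_step_on_first_tape t C :
  machine_step (on_first_tape t) C <->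
  exists2 t', step1 t t' & C = on_first_tape t'.
Proof.
split=> [[r st]|[t' [r rR st] ->]].
  exists (C ord0).
    exists (ssval r); first exact: ssvalP.
    by have := st ord0; rewrite ffunE.
  apply/ffunP => i; rewrite ffunE; case: ifP => i0.
    by congr (C _); apply/val_inj/eqP; rewrite i0.
  have := st i; rewrite ffunE /= i0 => -[x [y [_ -> /(_ isT)-> /(_ isT)->]]].
  by [].
exists (SeqSub rR) => i; rewrite !ffunE /=; case: ifP => // _.
by exists [::], [::].
Qed.

Lemma machine_reachP m t t' :
  reach (@machine_step _ _ M) (@config_size _ _ M) m
    (on_first_tape t) (on_first_tape t') <-> tape_reach m t t'.
Proof.
split; last first.
  elim=> [z lez|x y z lex st _ IH].
    by apply: reach_refl; rewrite config_size_on_first_tape.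
  apply: reach_cons IH; rewrite ?config_size_on_first_tape //.
  by apply/machine_step_on_first_tape; exists y.
suff gen C C' : reach (@machine_step _ _ M) (@config_size _ _ M) m C C' ->
    forall t, C = on_first_tape t -> C' = on_first_tape t' -> tape_reach m t t'.
  by move=> /gen; apply.
elim=> {C C' t} [C leC|C D E leC st _ IH] t eC eE.
  move: eE leC; rewrite eC => /on_first_tape_inj->.
  by rewrite config_size_on_first_tape; apply: reach_refl.
move: leC st; rewrite eC config_size_on_first_tape => leC.
move=> /machine_step_on_first_tape[t1 st eD].
exact: reach_cons leC st (IH _ eD eE).
Qed.

(** * Comparison of the languages and of the spaces *)

Notation machine_reach m u :=
  (reach (@machine_step _ _ M) (@config_size _ _ M) m
     (input_config M u) (accept_config M)).

Lemma machine_reach_of_group_reach m w :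
  group_reach m [:: w] [::] -> machine_reach (2 * m).+1 w.
Proof.
by rewrite input_configE accept_configE machine_reachP; apply: tape_reach_accept.
Qed.

Lemma group_reach_of_machine_reach m (w : word A) :
  machine_reach m w -> group_reach m.+1 [:: w] [::].
Proof.
rewrite input_configE accept_configE machine_reachP => /decode_reach.
by rewrite /decode /= /entries cut_letters /= cats0.
Qed.

(** The empty tape is accepted at once. The general bound would only give space 1, which cannot be
    absorbed at length 0. *)
Lemma machine_reach_nil : machine_reach 0 [::].
Proof.
rewrite input_configE accept_configE machine_reachP.
by apply: reach1 => //; apply/step1P; constructor.
Qed.

Lemma accepts_trivial (w : word A) : accepts M w <-> trivial_in_group R w.
Proof.
split=> [[s rs]|/reach_of_trivial[m /machine_reach_of_group_reach]].
  have : machine_reach (run_space (@config_size _ _ M) (input_config M w) s) w.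
    by apply/reachP; exists s.
  by move/group_reach_of_machine_reach/trivial_of_reach.
by case/reachP=> s rs _; exists s.
Qed.

Lemma word_space_le_input_space (w : word A) : trivial_in_group R w ->
  word_space R w <= (input_space M w).+1.
Proof.
move=> /reach_of_trivial[m /machine_reach_of_group_reach mw].
have [re _] := min_spaceP mw.
exact: (min_spaceP (group_reach_of_machine_reach re)).2.
Qed.

Lemma input_space_le_word_space (w : word A) : trivial_in_group R w ->
  input_space M w <= (2 * word_space R w).+1.
Proof.
move=> /reach_of_trivial[m mw]; have [re _] := min_spaceP mw.
exact: (min_spaceP (machine_reach_of_group_reach re)).2.
Qed.

Lemma word_space_nil : word_space R [::] = 0.
Proof.
apply/eqP; rewrite -leqn0; apply: (min_spaceP (m := 0) _).2.
apply: reach1; rewrite ?total_length1 // /total_length ?big_nil //.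
exact: (@elem_delete _ _ [::] [::]).
Qed.

Lemma input_space_nil : input_space M [::] = 0.
Proof. by apply/eqP; rewrite -leqn0; apply: (min_spaceP machine_reach_nil).2. Qed.

Lemma le_space_function n w :
  trivial_in_group R w -> size w <= n -> word_space R w <= space_function R n.
Proof.
move=> w1 lew; have [b leb] := short_words_bounded (word_space R) n.
apply: (@le_nat_max _ b) => [k [u [_ leu ->]]|]; first exact: leb.
by exists w.
Qed.

Lemma le_space_complexity n (w : word A) :
  trivial_in_group R w -> size w <= n -> input_space M w <= space_complexity M n.
Proof.
move=> w1 lew; have [b leb] := short_words_bounded (input_space M) n.
apply: (@le_nat_max _ b) => [k [u [_ leu ->]]|]; first exact: leb.
by exists w; split=> //; apply/accepts_trivial.
Qed.

Lemma space_function_growth_equiv :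
  growth_equiv (space_function R) (space_complexity M).
Proof.
(* The bounds for one word are [S_G <= S_M + 1] and [S_M <= 2 * S_G + 1], whence the constants 1 and
   2. A nonempty word forces [n > 0], so [c * n] absorbs the 1; the empty word needs no space. *)
split; [exists 1 | exists 2]; split=> // n; apply: nat_max_le => k [w []].
  case: w => [_ _ ->|a w w1 /= lew ->]; first by rewrite word_space_nil.
  have := word_space_le_input_space w1.
  have := le_space_complexity w1 lew; rewrite !mul1n; lia.
move/accepts_trivial; case: w => [_ _ ->|a w w1 /= lew ->].
  by rewrite input_space_nil.
(* The constant 2 also rescales the argument; the word has length at most [n], hence at most
   [2 * n]. *)
have : word_space R (a :: w) <= space_function R (2 * n).
  by apply: le_space_function => //=; lia.
by move=> le_ws; apply: leq_trans (input_space_le_word_space w1) _; lia.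
Qed.

End Machine.

Theorem proposition1p1 (A : finType) (R : seq (word A)) :
  exists M : turing_machine (A * bool)%type 2,
    growth_equiv (space_function R) (space_complexity M) /\
    forall u : word A, accepts M u <-> trivial_in_group R u.
Proof.
exists (group_machine R); split; first exact: space_function_growth_equiv.
exact: accepts_trivial.
Qed.
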